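(* For every $q \geq 2$ and $n \geq 2$ we have $$N_3(q,n)=P_{q-1}(n)+1 .$$
   Context: All parameters are integers. Let $K^3_N$ denote the complete $3$-uniform hypergraph on the ordered vertex set $\{1,\ldots,N\}$, i.e. all $3$-element subsets of $\{1,\ldots,N\}$. For vertices $x_1<x_2<\cdots<x_{n+2}$, the $n$ edges $\{x_i,x_{i+1},x_{i+2}\}$, $1\le i\le n$, form a monotone path of length $n$ (length is the number of edges). $N_3(q,n)$ is the smallest integer $N$ such that every coloring of the edges of $K^3_N$ with $q$ colors contains a monochromatic monotone path of length $n$ (all $n$ edges having the same color). A $d$-dimensional $n\times\cdots\times n$ partition with entries from $\{0,1,\ldots,n\}$ is a $d$-dimensional (hyper)matrix $A=(A_{i_1,\ldots,i_d})_{1\le i_1,\ldots,i_d\le n}$ with $A_{i_1,\ldots,i_d}\in\{0,1,\ldots,n\}$ that is (weakly) decreasing in each line: $A_{i_1,\ldots,i_t,\ldots,i_d}\ge A_{i_1,\ldots,i_t+1,\ldots,i_d}$ for all $1\le t\le d$ and all indices for which both sides are defined. $P_d(n)$ is the number of such partitions. *)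

(* Defs.v *)
From mathcomp Require Import all_boot.
Set Implicit Arguments.
Unset Strict Implicit.
Unset Printing Implicit Defensive.

(* Vertices 1, ..., N are shifted to 0, ..., N - 1, that is, to 'I_N. *)
Definition edge (N : nat) := {e : {set 'I_N} | #|e| == 3}.

Definition coloring (N q : nat) := edge N -> 'I_q.

Definition monotone (N m : nat) (x : 'I_m -> 'I_N) : Prop :=
  forall i j : 'I_m, i < j -> x i < x j.

(* All of i, i + 1, i + 2 are smaller than n + 2, so inord does not hit its
   default value here. *)
Definition path_edge (N n : nat) (x : 'I_n.+2 -> 'I_N) (i : 'I_n) :
    {set 'I_N} :=
  [set x (inord i); x (inord i.+1); x (inord i.+2)].

(* When x is monotone each path_edge x i has exactly three elements, so exactly
   one e : edge N satisfies val e = path_edge x i: the quantification over e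
   only serves to read off the color of that edge. *)
Definition has_mono_path (N q n : nat) (c : coloring N q) : Prop :=
  exists x : 'I_n.+2 -> 'I_N, monotone x /\
  exists k : 'I_q, forall (i : 'I_n) (e : edge N),
    val e = path_edge x i -> c e = k.

Definition forces_mono_path (q n N : nat) : Prop :=
  forall c : coloring N q, has_mono_path n c.

(* The graph of (q, n) |-> N_3(q, n): is_N3 q n N says that the minimum exists
   and is equal to N. *)
Definition is_N3 (q n N : nat) : Prop :=
  forces_mono_path q n N /\ forall M : nat, forces_mono_path q n M -> N <= M.

(* Positions (i_1, ..., i_d), each coordinate shifted from 1..n to 0..n-1. *)
Definition position (d n : nat) := {ffun 'I_d -> 'I_n}.

Definition hypermatrix (d n : nat) := {ffun position d n -> 'I_n.+1}.

Definition next_along (d n : nat) (t : 'I_d) (i j : position d n) : bool :=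
  (j t == (i t).+1 :> nat) && [forall s, (s != t) ==> (j s == i s)].

Definition is_partition (d n : nat) (A : hypermatrix d n) : bool :=
  [forall t, forall i, forall j, next_along t i j ==> (A j <= A i)].

Definition P (d n : nat) : nat := #|[set A : hypermatrix d n | is_partition A]|.

(* Main.v *)
Require Import Defs.
From mathcomp Require Import all_boot.

Set Implicit Arguments.
Unset Strict Implicit.
Unset Printing Implicit Defensive.

(** Both sides of the equality are compared with one intermediate object: a
    labelling of the pairs x < y of vertices by vectors L x y in
    {0, ..., n - 1}^q such that L y z is never coordinatewise below L x y when
    x < y < z.

    Such labellings encode colorings without a monochromatic monotone path of
    length n.  From the coloring, let the coordinate L x y k be the length of
    the longest path of color k whose last two vertices are x and y
    ([labelling_of_coloring]); an edge x < y < z of color k prolongs these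
    paths, so coordinate k grows from (x, y) to (y, z).  From the labelling,
    color x < y < z by a coordinate that grows ([coloring_of_labelling]): a
    monochromatic path of length n would give n + 1 strictly increasing numbers
    below n.

    Such labellings also encode chains of partitions.  Seen as a stack of unit
    boxes, a (q - 1)-dimensional partition is a down-set of {0, ..., n - 1}^q.
    Given a labelling, send y to the down-set generated by the labels L x y,
    x < y: for y < z the label L y z lies in the down-set of z but not in that
    of y, so the N down-sets are distinct and N <= P (q - 1) n
    ([labelling_card]).  Conversely, list the partitions by increasing number
    of boxes: a later partition is never contained in an earlier one, and a box
    of the partition of y that is missing from the partition of x can serve as
    L x y ([labelling_of_partitions]). *)

(** * Labellings of pairs *)

Definition labelling (N q n : nat) (L : 'I_N -> 'I_N -> position q n) : Prop :=
  forall x y z : 'I_N, x < y -> y < z -> exists k, L x y k < L y z k.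

(** * Labellings and colorings *)

(** A relation rather than a function of x, y, z: an edge is a set with a proof
    that it has three elements, and this form needs no default color for
    triples with repetitions. *)
Definition has_color N q (c : coloring N q) k (x y z : 'I_N) : bool :=
  [exists e : edge N, (val e == [set x; y; z]) && (c e == k)].

Lemma card_triple N (x y z : 'I_N) : x < y -> y < z -> #|[set x; y; z]| == 3.
Proof.
move=> xy yz; rewrite setUC cardsU1 cards2 !inE -!val_eqE /=.
by rewrite (ltn_eqF xy) (gtn_eqF yz) (gtn_eqF (ltn_trans xy yz)).
Qed.

Lemma has_color_exists N q (c : coloring N q) (x y z : 'I_N) :
  x < y -> y < z -> exists k, has_color c k x y z.
Proof.
move=> xy yz; pose e : edge N := Sub [set x; y; z] (card_triple xy yz).
by exists (c e); apply/existsP; exists e; rewrite SubK !eqxx.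
Qed.

Lemma has_color_val N q (c : coloring N q) k (x y z : 'I_N) (e : edge N) :
  has_color c k x y z -> val e = [set x; y; z] -> c e = k.
Proof.
case/existsP=> e' /andP[/eqP He' /eqP <-] He.
by congr c; apply: val_inj; rewrite He He'.
Qed.

(** A monotone path with m edges of color k whose last two vertices are x and
    y; for m = 0 it consists of these two vertices. *)
Fixpoint path_to N q (c : coloring N q) k m (x y : 'I_N) : bool :=
  if m is m'.+1 then
    (x < y) && [exists w, path_to c k m' w x && has_color c k w x y]
  else x < y.

Lemma path_to_vertices N q (c : coloring N q) k m (x y : 'I_N) :
    path_to c k m x y ->
  exists p : nat -> 'I_N, [/\ p m = x, p m.+1 = y,
    forall i, i <= m -> p i < p i.+1 &
    forall i, i < m -> has_color c k (p i) (p i.+1) (p i.+2)].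
Proof.
elim: m x y => [|m IHm] x y /=.
  by move=> xy; exists (fun i => if i is 0 then x else y); split=> // -[].
case/andP=> xy /existsP[w /andP[/IHm[p [pm pm1 p_lt p_col]] col]].
exists (fun i => if i <= m.+1 then p i else y); split=> [||i le_im|i lt_im].
- by rewrite leqnn.
- by rewrite ltnn.
- rewrite le_im ltnS; case: (ltnP m i) => [lt_mi | /p_lt //].
  by rewrite (_ : i = m.+1) ?pm1 //; apply/eqP; rewrite eqn_leq le_im.
- rewrite (ltnW lt_im) ltnS -ltnS lt_im !ltnS.
  case: (ltnP i m) => [/p_col // | le_mi].
  by rewrite (_ : i = m) ?pm ?pm1 //; apply/eqP; rewrite eqn_leq -ltnS lt_im.
Qed.

Lemma path_to_mono N q (c : coloring N q) k n (x y : 'I_N) :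
  path_to c k n x y -> has_mono_path n c.
Proof.
case/path_to_vertices=> p [_ _ p_lt p_col]; exists (fun i => p i); split.
  move=> i [j /=]; rewrite ltnS; elim: j => // j IHj le_jn.
  rewrite ltnS leq_eqVlt => /predU1P[->|lt_ij]; first exact: p_lt.
  by apply: ltn_trans (p_lt j le_jn); apply: IHj => //; apply: ltnW.
exists k => i e; rewrite /path_edge !inordK.
- by apply: has_color_val; apply: p_col.
- by rewrite !ltnS.
- by rewrite ltnS ltnW // ltnS.
- by rewrite ltnW // ltnW // !ltnS.
Qed.

Lemma labelling_of_coloring N q n (c : coloring N q) :
  has_mono_path n.+1 c \/ exists L : 'I_N -> 'I_N -> position q n.+1, labelling L.
Proof.
have [/existsP[k /existsP[x /existsP[y cxy]]] | no_path] :=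
  boolP [exists k, [exists x, [exists y, path_to c k n.+1 x y]]].
  by left; apply: path_to_mono cxy.
right; exists (fun x y =>
  [ffun k => [arg max_(m > ord0 | path_to c k m x y) (m : nat)]]).
move=> x y z xy yz; have [k col] := has_color_exists c xy yz.
exists k; rewrite !ffunE.
case: arg_maxnP => // m cxy _; case: arg_maxnP => // m' _ max_m'.
have cyz: path_to c k m.+1 y z.
  by rewrite /= yz; apply/existsP; exists x; rewrite cxy.
(* Labels are bounded by n, so prolonging may only overflow them at a path of
   length n + 1, which is excluded. *)
have [lt_mn | le_nm] := ltnP m.+1 n.+1; first exact: (max_m' (Ordinal lt_mn)).
case/negP: no_path; apply/existsP; exists k; apply/existsP; exists y.
apply/existsP; exists z; suff <-: m.+1 = n.+1 by [].
by apply/eqP; rewrite eqn_leq le_nm ltn_ord.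
Qed.

Lemma enum_triple N (x y z : 'I_N) :
  x < y -> y < z -> enum [set x; y; z] = [:: x; y; z].
Proof.
move=> xy yz; apply: (@irr_sorted_eq _ (fun i j : 'I_N => i < j)).
- by move=> a b c; apply: ltn_trans.
- by move=> a; apply: ltnn.
- apply: sorted_filter; first by move=> a b c; apply: ltn_trans.
  have := iota_ltn_sorted 0 N.
  by rewrite -val_enum_ord sorted_map enumT.
- by rewrite /= xy yz.
- by move=> w; rewrite mem_enum !inE orbA.
Qed.

Lemma coloring_of_labelling N d n (L : 'I_N -> 'I_N -> position d.+1 n) :
  labelling L -> exists c : coloring N d.+1, ~ has_mono_path n c.
Proof.
move=> labL.
pose grow x y z := odflt ord0 [pick k | L x y k < L y z k].
have growP (x y z : 'I_N) : x < y -> y < z -> L x y (grow x y z) < L y z (grow x y z).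
  move=> xy yz; rewrite /grow; case: pickP => // no_k.
  by have [k] := labL _ _ _ xy yz; rewrite no_k.
(* The enumeration of an edge lists its vertices in increasing order. *)
exists (fun e : edge N => if enum (val e) is [:: x; y; z] then grow x y z else ord0).
case=> v [v_mono [k v_col]].
pose w i := v (inord i).
have w_lt i : i <= n -> w i < w i.+1.
  by move=> le_in; apply: v_mono; rewrite !inordK // ltnS ltnW.
have L_lt i : i < n -> L (w i) (w i.+1) k < L (w i.+1) (w i.+2) k.
  move=> lt_in; have lt1 := w_lt i (ltnW lt_in); have lt2 := w_lt i.+1 lt_in.
  pose e : edge N := Sub [set w i; w i.+1; w i.+2] (card_triple lt1 lt2).
  have := v_col (Ordinal lt_in) e erefl.
  by rewrite SubK enum_triple // => <-; apply: growP.
have L_ge i : i <= n -> i <= L (w i) (w i.+1) k.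
  by elim: i => // i IHi lt_in; apply: leq_ltn_trans (L_lt _ lt_in); apply/IHi/ltnW.
by have := L_ge n (leqnn n); rewrite leqNgt ltn_ord.
Qed.

(** * Labellings and partitions *)

(** The height above i of the down-set generated by the labels L x y, x < y,
    where coordinate 0 of a label is the vertical one. *)
Definition height N d n (L : 'I_N -> 'I_N -> position d.+1 n) (y : 'I_N)
    (i : position d n) : nat :=
  \max_(x < N | (x < y) && [forall t, i t <= L x y (lift ord0 t)]) (L x y ord0).+1.

Lemma height_le N d n (L : 'I_N -> 'I_N -> position d.+1 n) y i :
  height L y i <= n.
Proof. by apply/bigmax_leqP=> x _; apply: ltn_ord. Qed.

Lemma labelling_card N d n (L : 'I_N -> 'I_N -> position d.+1 n) :
  labelling L -> N <= P d n.
Proof.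
move=> labL.
pose A y : hypermatrix d n := [ffun i => inord (height L y i)].
have AE y i : A y i = height L y i :> nat.
  by rewrite ffunE inordK // ltnS height_le.
have A_part y : is_partition (A y).
  apply/forallP=> t; apply/forallP=> i; apply/forallP=> j; apply/implyP.
  case/andP=> /eqP jt /forallP js; rewrite !AE.
  apply/bigmax_leqP=> x /andP[xy /forallP j_le].
  apply: (leq_bigmax_cond (F := fun x => (L x y ord0).+1)); rewrite xy; apply/forallP=> s.
  apply: leq_trans (j_le s); have [->|ne_st] := eqVneq s t; first by rewrite jt.
  by have := js s; rewrite ne_st => /eqP->.
have A_neq (y z : 'I_N) : y < z -> A y <> A z.
  (* The height of z above the projection i of L y z separates A y from A z. *)
  move=> yz eqA; pose i : position d n := [ffun t => L y z (lift ord0 t)].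
  have: height L y i < height L z i.
    apply: (@leq_trans (L y z ord0).+1); last first.
      apply: (leq_bigmax_cond (F := fun x => (L x z ord0).+1)); rewrite yz.
      by apply/forallP=> t; rewrite ffunE.
    rewrite ltnS; apply/bigmax_leqP=> x /andP[xy /forallP i_le].
    have [k] := labL _ _ _ xy yz; case: (unliftP ord0 k) => [t|] -> //.
    by have := i_le t; rewrite ffunE ltnNge => ->.
  by rewrite -!AE eqA ltnn.
have A_inj : injective A.
  move=> y z eqA; apply: val_inj => /=.
  by case: (ltngtP y z) => // [/A_neq | /A_neq /nesym]; rewrite eqA.
rewrite -[N]card_ord -(card_imset _ A_inj) subset_leq_card //.
by apply/subsetP=> _ /imsetP[y _ ->]; rewrite inE.
Qed.

(** A partition is only required to decrease along unit steps; a pair i <= j is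
    joined by such steps, by induction on the distance. *)
Lemma partition_homo d n (A : hypermatrix d n) (i j : position d n) :
  is_partition A -> (forall t, i t <= j t) -> A j <= A i.
Proof.
move=> A_part; move: {2}(\sum_t (j t - i t)) (erefl (\sum_t (j t - i t))) => m.
elim: m i => [|m IHm] i dist le_ij.
  suff -> : i = j by [].
  apply/ffunP=> t; apply/val_inj/eqP; rewrite /= eqn_leq le_ij -subn_eq0 /=.
  by move/eqP: dist; rewrite sum_nat_eq0 => /forallP/(_ t).
have [t lt_ij] : exists t, i t < j t.
  apply/existsP; apply: contraT; rewrite negb_exists => /forallP ge_ij.
  have: \sum_t (j t - i t) = 0.
    by apply: big1 => t _; apply/eqP; rewrite subn_eq0 leqNgt ge_ij.
  by rewrite dist.
have lt_in : (i t).+1 < n by apply: leq_ltn_trans lt_ij _.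
pose i' : position d n := [ffun s => if s == t then Ordinal lt_in else i s].
have i't : i' t = (i t).+1 :> nat by rewrite ffunE eqxx.
have i's s : s != t -> i' s = i s by move=> ne_st; rewrite ffunE (negPf ne_st).
have step : A i' <= A i.
  move/forallP/(_ t)/forallP/(_ i)/forallP/(_ i')/implyP: A_part; apply.
  by rewrite /next_along i't eqxx; apply/forallP=> s; apply/implyP=> /i's->.
apply: leq_trans step; apply: IHm => [|s]; last first.
  by have [->|/i's->] := eqVneq s t; rewrite ?i't.
apply: succn_inj; rewrite -dist (bigD1 t) //= i't [RHS](bigD1 t) //=.
rewrite -addSn subnSK //; congr (_ + _).
by apply: eq_bigr => s /i's->.
Qed.

(** A vertex is a partition, and a label is a box.  The label of x < y is the
    lowest box of its column that does not belong to the partition of x. *)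
Lemma labelling_of_partitions N d n :
    N <= P d n.+1 ->
  exists L : 'I_N -> 'I_N -> position d.+1 n.+1, labelling L.
Proof.
move=> le_NP.
pose boxes (A : hypermatrix d n.+1) := \sum_i A i.
pose by_boxes A B := boxes A <= boxes B.
pose s := sort by_boxes (enum [set A : hypermatrix d n.+1 | is_partition A]).
have lt_s (x : 'I_N) : x < size s.
  by rewrite size_sort -cardE; apply: leq_trans le_NP.
pose A (x : 'I_N) := nth [ffun=> ord0] s x.
have A_part x : is_partition (A x).
  by have := mem_nth [ffun=> ord0] (lt_s x); rewrite mem_sort mem_enum inE.
have A_lt (x y : 'I_N) : x < y -> exists i, A x i < A y i.
  move=> xy; apply/existsP; apply: contraT; rewrite negb_exists => /forallP ge_A.
  have le_yx i : A y i <= A x i by rewrite leqNgt ge_A.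
  have le_xy : boxes (A x) <= boxes (A y).
    apply: (@sorted_leq_nth _ by_boxes); rewrite ?inE ?lt_s ?(ltnW xy) //.
    - by move=> B C D; apply: leq_trans.
    - by move=> B; apply: leqnn.
    - by apply: sort_sorted => B C; apply: leq_total.
  have eqA : A y = A x.
    apply/ffunP=> i; apply/val_inj/eqP.
    have [_] := leqif_sum (fun i (_ : true) => leqif_eq (le_yx i)).
    by rewrite eqn_leq le_xy leq_sum // => /esym/forallP/(_ i).
  by move/eqP: eqA; rewrite nth_uniq ?sort_uniq ?enum_uniq ?lt_s // gtn_eqF.
pose col x y := odflt [ffun=> ord0] [pick i | A x i < A y i].
have colP (x y : 'I_N) : x < y -> A x (col x y) < A y (col x y).
  move=> xy; rewrite /col; case: pickP => // no_i.
  by have [i] := A_lt x y xy; rewrite no_i.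
exists (fun x y => [ffun k =>
  if unlift ord0 k is Some t then col x y t else inord (A x (col x y))]).
move=> x y z xy yz; apply/existsP; apply: contraT; rewrite negb_exists => /forallP le.
(* The box of (x, y) lies in A y, hence so would the smaller box of (y, z). *)
have le_col t : col y z t <= col x y t.
  by have := le (lift ord0 t); rewrite !ffunE liftK -leqNgt.
have := le ord0; rewrite !ffunE unlift_none -leqNgt !inordK.
- move=> le_A; have := leq_trans (colP x y xy) (partition_homo (A_part y) le_col).
  by rewrite ltnNge le_A.
- by apply: leq_trans (colP _ _ xy) _; rewrite -ltnS.
- by apply: leq_trans (colP _ _ yz) _; rewrite -ltnS.
Qed.

Theorem theorem1 (q n : nat) (hq : 2 <= q) (hn : 2 <= n) :
  is_N3 q n (P q.-1 n + 1).
Proof.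
case: q n hq hn => [|d] [|n] // _ _; rewrite addn1; split=> [c | M forces].
  have [// | [L /labelling_card]] := labelling_of_coloring n c.
  by rewrite ltnn.
rewrite ltnNge; apply/negP=> /labelling_of_partitions[L /coloring_of_labelling].
by case=> c; apply; apply: forces.
Qed.
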